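(* Let $f$, $g$, $q=f+g$ be as in the context and suppose that: (a) $q$ is bounded from below on $\operatorname{dom} g$; (b) $g$ is bounded from below by an affine function; (c) $\nabla f:\mathbb X\to\mathbb X$ is locally Lipschitz continuous; (d) $q$ is continuous on $\operatorname{dom} q$. Let $\{x^k\}_{k\in\mathbb N}$ be any sequence generated by the nonmonotone proximal gradient method with max line search described in the context. Suppose that $\{x^k\}_{k\in\mathcal K}$ is a subsequence converging to some limit point $\bar x$, and that $q$ has the KL property at $\bar x$. Then the entire sequence $\{x^k\}_{k\in\mathbb N}$ converges to $\bar x$.
   Context: $\mathbb X$ is a Euclidean space (real finite-dimensional Hilbert space) with inner product $\langle\cdot,\cdot\rangle$ and norm $\|\cdot\|$. $f:\mathbb X\to\mathbb R$ is continuously differentiable, $g:\mathbb X\to\mathbb R\cup\{+\infty\}$ is lower semicontinuous, $q:=f+g$, and $\operatorname{dom} h:=\{x: h(x)<\infty\}$. Nonmonotone proximal gradient method with max line search. Parameters: $\tau>1$, $0<\gamma_{\min}\le\gamma_{\max}<\infty$, $m\in\mathbb N$, $\delta\in(0,1)$, a starting point $x^0\in\operatorname{dom} q$. For $k=0,1,2,\dots$: set $m_k:=\min\{k,m\}$ and choose $\gamma_k^0\in[\gamma_{\min},\gamma_{\max}]$; for $i=0,1,2,\dots$ compute a (global) solution $x^{k,i}$ of $$\min_{x\in\mathbb X}\ f(x^k)+\langle\nabla f(x^k),x-x^k\rangle+\frac{\gamma_{k,i}}{2}\|x-x^k\|^2+g(x),\qquad \gamma_{k,i}:=\tau^i\gamma_k^0,$$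 until $q(x^{k,i})\le\max_{j=0,\dots,m_k}q(x^{k-j})-\delta\frac{\gamma_{k,i}}{2}\|x^{k,i}-x^k\|^2$ holds. Let $i_k$ be the terminal value of $i$ (the first index at which this holds) and set $\gamma_k:=\gamma_{k,i_k}$, $x^{k+1}:=x^{k,i_k}$. The method is assumed to run without terminating, so that it generates an infinite sequence. Subdifferentials. For lower semicontinuous $h:\mathbb X\to\mathbb R\cup\{+\infty\}$ and $x\in\operatorname{dom} h$, the regular subdifferential is $\widehat\partial h(x):=\{\eta: \liminf_{y\to x,\,y\ne x}\frac{h(y)-h(x)-\langle\eta,y-x\rangle}{\|y-x\|}\ge0\}$, and the limiting subdifferential $\partial h(x)$ is the set of all $\eta$ for which there are $x^j\to x$ with $h(x^j)\to h(x)$ and $\eta^j\to\eta$ with $\eta^j\in\widehat\partial h(x^j)$ for all $j$. $\operatorname{dist}(x,A):=\inf\{\|y-x\|: y\in A\}$, with $\operatorname{dist}(x,\emptyset):=\infty$. KL property. A lower semicontinuous $h$ has the KL property at $x^*\in\{x:\partial h(x)\ne\emptyset\}$ if there exist $\eta>0$, a neighborhood $U$ of $x^*$, and a continuous concave function $\chi:[0,\eta]\to[0,\infty)$, continuously differentiable on $(0,\eta)$, with $\chi(0)=0$ and $\chi'(t)>0$ for $t\in(0,\eta)$, such that $\chi'(h(x)-h(x^* ))\operatorname{dist}(0,\partial h(x))\ge1$ for all $x\in U$ with $h(x^* )<h(x)<h(x^* )+\eta$. *)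

(* Defs.v *)
From HB Require Import structures.
From mathcomp Require Import all_boot all_order all_algebra.
From mathcomp Require Import sesquilinear.
From mathcomp Require Import all_classical all_reals all_analysis.
Set Implicit Arguments.
Unset Strict Implicit.
Unset Printing Implicit Defensive.
Import Order.TTheory GRing.Theory Num.Theory.
Import numFieldNormedType.Exports.
Local Open Scope classical_set_scope.
Local Open Scope ring_scope.

(* The norm (hence the topology) of the space is the one of the inner product;
   finite dimension comes from Vector. *)
HB.mixin Record NormedModule_isInner (R : realType) X
    & NormedModule R X := {
  inner : {dot X for @idfun R} ;
  inner_normE : forall x : X, inner x x = `|x| ^+ 2
}.

#[short(type="euclideanType")]
HB.structure Definition Euclidean (R : realType) :=
  {X of NormedModule R X & Vector R X & NormedModule_isInner R X}.

Notation "''[' x , y ]" := (inner x y) : ring_scope.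

Section ExtendedValuedFunctions.
Context {R : realType} {X : euclideanType R}.
Implicit Types (h : X -> \bar R) (x eta : X) (A : set X).
Local Open Scope ereal_scope.

Definition dom h : set X := [set x | h x < +oo].

Definition is_global_min h x : Prop := forall y, h x <= h y.

Definition affinely_minorized h : Prop :=
  exists (a : X) (b : R), forall x, ('[a, x] + b)%:E <= h x.

(* The difference quotient is taken along the punctured neighborhoods x^'. *)
Definition regular_subdiff h x : set X :=
  [set eta | dom h x /\
     0 <= limf_einf (fun y => (h y - h x - '[eta, (y - x)%R]%:E)
                              * (`|y - x|^-1)%:E) x^'].

Definition limiting_subdiff h x : set X :=
  [set eta | dom h x /\
     exists (xs etas : nat -> X),
       [/\ xs @ \oo --> x, (h \o xs) @ \oo --> h x, etas @ \oo --> eta &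
           forall j, regular_subdiff h (xs j) (etas j)]].

(* The infimum over the empty set is +oo. *)
Definition dist x A : \bar R := ereal_inf [set (`|y - x|)%:E | y in A].

(* Values of chi outside [0, eta] are irrelevant. *)
Definition desingularizing (eta : R) (chi : R -> R) : Prop :=
  [/\ (forall t : R, t \in `[0%R, eta] -> (0 <= chi t)%R),
      {within `[0%R, eta], continuous chi},
      @convex_function R R^o `[0%R, eta]%classic (fun t => - chi t)%R,
      chi 0%R = 0%R &
      forall t : R, t \in `]0%R, eta[ ->
        [/\ derivable chi t 1, {for t, continuous (derive1 chi)} &
            (0 < derive1 chi t)%R]].

Definition KL_property h (xstar : X) : Prop :=
  limiting_subdiff h xstar !=set0 /\
  exists (eta : R) (U : set X) (chi : R -> R),
    [/\ (0 < eta)%R, nbhs xstar U, desingularizing eta chi &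
        forall x, U x -> h xstar < h x -> h x < h xstar + eta%:E ->
          1 <= (derive1 chi (fine (h x - h xstar)))%:E
               * dist 0%R (limiting_subdiff h x)].

End ExtendedValuedFunctions.

Section SmoothFunctions.
Context {R : realType} {X : euclideanType R}.

Definition is_gradient (f : X -> R) (gradf : X -> X) : Prop :=
  forall x, differentiable f x /\ forall v, 'd f x v = '[gradf x, v].

Definition locally_lipschitz (F : X -> X) : Prop :=
  forall x : X, exists2 U, nbhs x U & [lipschitz F y | y in U].

End SmoothFunctions.

Section NonmonotoneProximalGradient.
Context {R : realType} {X : euclideanType R}.
Variables (f : X -> R) (gradf : X -> X) (g : X -> \bar R).
Local Open Scope ereal_scope.

Definition composite (x : X) : \bar R := (f x)%:E + g x.

Definition prox_model (gamma : R) (z x : X) : \bar R :=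
  (f z + '[gradf z, (x - z)%R] + gamma / 2 * `|x - z| ^+ 2)%:E + g x.

(* max_{j = 0, .., min(k, m)} q(x^{k-j}); the neutral element -oo plays no
   role since j = 0 always belongs to the range. *)
Definition max_window (m : nat) (x : nat -> X) (k : nat) : \bar R :=
  \big[maxe/-oo]_(j < (minn k m).+1) composite (x (k - j)%N).

Definition acceptable (delta gamma : R) (m : nat) (x : nat -> X) (k : nat)
    (y : X) : Prop :=
  composite y <=
    max_window m x k - (delta * (gamma / 2) * `|y - x k| ^+ 2)%:E.

(* x is an infinite sequence of iterates; gamma0 k, trial k i and istop k are
   the initial stepsize parameter, the trial points and the terminal index of
   the inner loop in iteration k. *)
Definition npg_max_sequence (tau gmin gmax delta : R) (m : nat)
    (x : nat -> X) : Prop :=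
  dom composite (x 0%N) /\
  exists (gamma0 : nat -> R) (trial : nat -> nat -> X) (istop : nat -> nat),
    forall k : nat,
      let gamma i := (tau ^+ i * gamma0 k)%R in
      [/\ (gmin <= gamma0 k <= gmax)%R,
          (forall i, (i <= istop k)%N ->
             is_global_min (prox_model (gamma i) (x k)) (trial k i)),
          (forall i, (i < istop k)%N ->
             ~ acceptable delta (gamma i) m x k (trial k i)),
          acceptable delta (gamma (istop k)) m x k (trial k (istop k)) &
          x k.+1 = trial k (istop k)].

End NonmonotoneProximalGradient.

(* Main.v *)
(* Let N = m + 1, let Q_k be the maximum of q over the window ending at x^k and
   q* its limit, and let s_k = |x^{k+1} - x^k|. The value Q_{k+N} is attained
   at some x^l with k < l <= k + N. Minimality of the proximal step only lets q
   increase by O(s_j^2) from x^j to x^{j+1}, and the line search bounds s_j^2 by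
   a multiple of Q_k - q(x^{j+1}); going backwards from l this yields
   s_k^2 = O(Q_k - Q_{k+N}) for every k with x^k close to xbar, although only
   the steps into window maximizers are controlled directly. Step lengths are
   globally bounded, so the Lipschitz constant needed is that of a fixed ball.
   Applying the KL inequality at the maximizer attaining Q_k, with
   a_k = sqrt(Q_k - Q_{k+N}), gives
   2 a_k <= a_{k-N} + C (chi(Q_k - q* ) - chi(Q_{k+N} - q* ))
   as long as the last N + 1 iterates are close to xbar. Hence the a_k, and with
   them the steps, are summable, and an iterate close enough to xbar traps all
   subsequent ones near xbar. *)
Require Import Defs.
From HB Require Import structures.
From mathcomp Require Import all_boot all_order all_algebra.
From mathcomp Require Import sesquilinear.
From mathcomp Require Import all_classical all_reals all_analysis.
From mathcomp Require Import ring lra zify.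
Set Implicit Arguments.
Unset Strict Implicit.
Unset Printing Implicit Defensive.
Import Order.TTheory GRing.Theory Num.Theory.
Import numFieldNormedType.Exports.
Local Open Scope classical_set_scope.
Local Open Scope ring_scope.

(** * Euclidean geometry: Cauchy-Schwarz and compactness of closed balls *)

Section EuclideanSpace.
Context {R : realType} {X : euclideanType R}.
Import VectorInternalTheory.
Implicit Types x y z : X.

Lemma innerC x y : '[x, y] = '[y, x].
Proof. by rewrite (hermC (inner : {dot X for idfun})) expr0 mul1r. Qed.

Lemma innerDl x y z : '[x + y, z] = '[x, z] + '[y, z].
Proof. by rewrite linearDl. Qed.

Lemma innerDr x y z : '[x, y + z] = '[x, y] + '[x, z].
Proof. by rewrite linearDr. Qed.

Lemma innerNl x y : '[- x, y] = - '[x, y].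
Proof. by rewrite linearNl. Qed.

Lemma innerNr x y : '[x, - y] = - '[x, y].
Proof. by rewrite linearNr. Qed.

Lemma innerZl a x y : '[a *: x, y] = a * '[x, y].
Proof. by rewrite linearZl_LR. Qed.

Lemma innerZr a x y : '[x, a *: y] = a * '[x, y].
Proof. by rewrite linearZr_LR. Qed.

Lemma normD_sqr x y : `|x + y| ^+ 2 = `|x| ^+ 2 + 2 * '[x, y] + `|y| ^+ 2.
Proof.
by rewrite -!inner_normE innerDl !innerDr (innerC y x); ring.
Qed.

(** Cauchy-Schwarz: for nonzero [x] and [y], expand the square of the norm of [|y| x - |x| y] and
    divide by [|x| |y|]. *)
Lemma inner_le x y : '[x, y] <= `|x| * `|y|.
Proof.
have := normr_ge0 x; rewrite le_eqVlt => /predU1P[/esym/eqP|x0].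
  by rewrite normr_eq0 => /eqP ->; rewrite linear0l normr0 mul0r.
have := normr_ge0 y; rewrite le_eqVlt => /predU1P[/esym/eqP|y0].
  by rewrite normr_eq0 => /eqP ->; rewrite linear0r normr0 mulr0.
have := sqr_ge0 `| `|y| *: x - `|x| *: y|.
rewrite normD_sqr normrN !normrZ !normr_id innerNr innerZl innerZr => h.
have xy0 : 0 < `|x| * `|y| by rewrite mulr_gt0.
rewrite -(ler_pM2l xy0); nra.
Qed.

Lemma r2v_continuous : continuous (@r2v _ X).
Proof.
have -> : @r2v _ X = fun u => \sum_(i < _) u 0 i *: r2v (delta_mx 0 i).
  by apply/funext => u; rewrite {1}(row_sum_delta u) linear_sum/=;
    apply: eq_bigr => i _; rewrite linearZ.
apply: (continuous_big (op := +%R)) => [|i _ u]; first exact: add_continuous.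
by apply: (@cvgZr_tmp R); [exact: nbhs_filter|exact: coord_continuous].
Qed.

(** One half of the equivalence of norms: [c] is the minimum of the norm of [r2v u] over the unit
    sphere of coordinate vectors, positive because [r2v] is injective. *)
Lemma r2v_bounded_below :
  exists2 c : R, 0 < c & forall u : 'rV[R]_(dim X), c * `|u| <= `|r2v u : X|.
Proof.
pose S := [set u : 'rV[R]_(dim X) | `|u| = 1].
have norm_r2v_cont : continuous (fun u : 'rV[R]_(dim X) => `|r2v u : X|).
  by move=> u; apply: continuous_comp;
    [exact: r2v_continuous|exact: norm_continuous].
have normalize (u : 'rV[R]_(dim X)) : u != 0 -> S (`|u|^-1 *: u).
  by move=> u0; rewrite /S/= normrZ normfV normr_id mulVf// normr_eq0.
(* In dimension 0 the sphere is empty and any constant works. *)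
have [S0|S0] := pselect (S !=set0); last first.
  exists 1 => // u; have [->|u0] := eqVneq u 0.
    by rewrite normr0 mulr0.
  by exfalso; apply: S0; exists (`|u|^-1 *: u); exact: normalize.
have Scompact : compact S.
  apply: bounded_closed_compact.
    by exists 1; split => // M M1 u /= ->; exact: ltW.
  rewrite (_ : S = Num.norm @^-1` [set 1])//.
  by apply: preimage_closed; [move=> u _; exact: norm_continuous|
     exact: closed_eq].
have [u0 /set_mem Su0 u0_min] := EVT_min_rV S0 Scompact
  (continuous_subspaceT norm_r2v_cont).
exists `|r2v u0 : X|.
  rewrite normr_gt0; apply/eqP => r2v0; move: Su0; rewrite /S/=.
  have -> : u0 = 0 by apply: (@r2v_inj _ X); rewrite r2v0 linear0.
  by rewrite normr0 => /eqP; rewrite eq_sym oner_eq0.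
move=> u; have [->|u_neq0] := eqVneq u 0; first by rewrite normr0 mulr0.
have := u0_min _ (mem_set (normalize _ u_neq0)).
by rewrite linearZ normrZ normfV normr_id -ler_pdivrMl ?invr_gt0 ?normr_gt0//
   invrK mulrC.
Qed.

(** The ball is the continuous image of a set of coordinate vectors that is closed, and bounded by
    [r2v_bounded_below]. *)
Lemma compact_norm_ball x (r : R) : compact [set y | `|y - x| <= r].
Proof.
have [c c0 cP] := r2v_bounded_below.
pose B := [set u : 'rV[R]_(dim X) | `|r2v u - x| <= r].
have -> : [set y | `|y - x| <= r] = r2v @` B.
  apply/seteqP; split => [y yx|_ [u Bu <-]//].
  by exists (v2r y); rewrite /B/= v2rK.
apply: continuous_compact.
  by apply: continuous_subspaceT; exact: r2v_continuous.
apply: bounded_closed_compact.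
  exists ((r + `|x|) / c); split; first exact: num_real.
  move=> M rM u Bu; apply/ltW/(le_lt_trans _ rM).
  rewrite ler_pdivlMr// mulrC (le_trans (cP u))//.
  by rewrite -(subrK x (r2v u)) (le_trans (ler_normD _ _))// lerD2r.
have -> : B = (fun u => `|r2v u - x|) @^-1` [set t | t <= r] by [].
apply: preimage_closed; last exact: closed_le.
move=> u _; have := @continuous_comp _ _ _
  (fun u : 'rV[R]_(dim X) => (r2v u : X) - x) Num.norm u.
apply; last exact: norm_continuous.
by apply: cvgB; [exact: nbhs_filter|exact: r2v_continuous|
  apply: cvg_cst; exact: nbhs_filter].
Qed.

End EuclideanSpace.

(** * Lipschitz gradients on compact sets and the descent inequality *)

Section SmoothFunctions.
Context {R : realType} {X : euclideanType R}.
Implicit Types (x y z : X) (K : set X).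

Lemma continuous_compact_bounded (V : normedModType R) (F : X -> V) K :
    continuous F -> compact K ->
  exists2 M : R, 0 < M & forall y, K y -> `|F y| <= M.
Proof.
move=> Fcont Kcomp.
have Fcont' : {within K, continuous F} by apply: continuous_subspaceT.
have /compact_bounded [M [_ MP]] := continuous_compact Fcont' Kcomp.
have MM : M < `|M| + 1 by rewrite (le_lt_trans (ler_norm M))// ltrDl.
exists (`|M| + 1); first by rewrite ltr_wpDl.
by move=> y Ky; apply: (MP _ MM); exists y.
Qed.

(** Near each point of [K], close pairs are handled by the local Lipschitz constant, and distant
    pairs by the bound [2 * M] on the difference of values; compactness makes the constant
    uniform. *)
Lemma locally_lipschitz_compact (F : X -> X) K :
    continuous F -> locally_lipschitz F -> compact K ->
  exists2 L : R, 0 < L & forall y z, K y -> K z -> `|F y - F z| <= L * `|y - z|.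
Proof.
move=> Fcont Flip Kcomp.
have [M M0 FM] := continuous_compact_bounded Fcont Kcomp.
suff : \forall L \near +oo,
    K `<=` [set y | forall z, K z -> `|F y - F z| <= L * `|y - z|].
  move=> [L0 [_ L0P]]; exists (Num.max L0 0 + 1).
    by rewrite ltr_wpDl// le_max lexx orbT.
  have L0lt : L0 < Num.max L0 0 + 1 by rewrite ltr_pwDr// le_max lexx.
  by move=> y z Ky Kz; apply: (L0P _ L0lt).
move/compact_near_coveringP/near_covering_withinP : Kcomp; apply => x Kx.
have [U /nbhs_ballP[e /= e0 eU] [L1 [_ L1P]]] := Flip x.
have e20 : 0 < e / 2 by rewrite divr_gt0.
(* The second term makes [2 * M <= L * |y - z|] as soon as [|y - z| >= e / 2]. *)
pose L2 := Num.max L1 (2 * M / (e / 2)).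
exists (ball x (e / 2), [set L | L2 < L]).
  by split; [exact: nbhsx_ballx|by exists L2; split => //; exact: num_real].
move=> [y L] [/= xy L2L] Ky z Kz.
move: L2L; rewrite /L2 gt_max => /andP[L1L ML].
have [yz|yz] := ltP `|y - z| (e / 2).
  apply: (L1P _ L1L (y, z)); split; apply: eU => /=.
    by apply: le_ball xy; rewrite ler_pdivrMr// ler_peMr ?ler1n// ltW.
  rewrite (splitr e); apply: (ball_triangle xy).
  by rewrite -ball_normE.
apply: (@le_trans _ _ (2 * M)).
  by rewrite (le_trans (ler_normB _ _))// mulr2n mulrDl mul1r lerD// FM.
rewrite ltr_pdivrMr// in ML.
apply/ltW/(lt_le_trans ML); rewrite ler_wpM2l//.
rewrite ltW// (lt_trans _ (_ : 2 * M / (e / 2) < L)) ?divr_gt0 ?mulr_gt0//.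
by rewrite ltr_pdivrMr.
Qed.

Lemma gradient_mean_value (f : X -> R) (gradf : X -> X) x y :
    is_gradient f gradf ->
  exists2 t : R, t \in `[0, 1] &
    f y - f x = '[gradf (x + t *: (y - x)), y - x].
Proof.
move=> fgrad; pose path (t : R) := x + t *: (y - x).
have dpath (t : R) : is_derive t (1 : R) path (y - x).
  rewrite [X in is_derive _ _ X](_ : path = cst x + *:%R^~ (y - x))//.
  rewrite -[X in is_derive _ _ _ X]add0r.
  have ds := is_diff_scalel t (y - x).
  apply: is_deriveD.
  apply: DeriveDef; first by apply: diff_derivable; case: ds.
  by rewrite deriveE ?diff_val ?scale1r//; case: ds.
have df (t : R) : is_derive t (1 : R) (f \o path) '[gradf (path t), y - x].
  have dp : differentiable path t by apply/derivable1_diffP; case: (dpath t).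
  have [df dfE] := fgrad (path t).
  apply: DeriveDef.
    by apply/derivable1_diffP/differentiable_comp.
  rewrite deriveE; last exact: differentiable_comp.
  by rewrite diff_comp//= dfE -deriveE// derive_val.
have [|t t01] := @MVT_segment R (f \o path) (fun t => '[gradf (path t), y - x])
  0 1 ler01 (fun t _ => df t).
  apply: continuous_subspaceT => t.
  by apply: differentiable_continuous; apply/derivable1_diffP; case: (df t).
rewrite /= /path scale0r addr0 scale1r (addrC x (y - x)) subrK subr0 mulr1 => tE.
by exists t.
Qed.

(** The mean value point [w] stays in the ball by convexity. Going through the mean value theorem
    rather than an integral costs a factor 2: the constant is [L] instead of [L / 2]. *)
Lemma descent_on_ball (f : X -> R) (gradf : X -> X) x (r L : R) :
    is_gradient f gradf -> 0 <= L ->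
    (forall y z, `|y - x| <= r -> `|z - x| <= r ->
       `|gradf y - gradf z| <= L * `|y - z|) ->
  forall y z, `|y - x| <= r -> `|z - x| <= r ->
    f y <= f z + '[gradf z, y - z] + L * `|y - z| ^+ 2.
Proof.
move=> fgrad L0 flip y z yr zr.
have [t] := gradient_mean_value z y fgrad; rewrite in_itv/= => /andP[t0 t1] fyz.
set w := z + t *: (y - z) in fyz.
have wz : w - z = t *: (y - z) by rewrite /w addrC addKr.
have wr : `|w - x| <= r.
  have -> : w - x = (1 - t) *: (z - x) + t *: (y - x).
    have -> : w - x = (z - x) + t *: ((y - x) - (z - x)).
      by rewrite opprB addrA subrK /w addrAC.
    by rewrite scalerBr scalerBl scale1r addrA addrAC.
  rewrite (le_trans (ler_normD _ _))// !normrZ ger0_norm ?subr_ge0//.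
  by rewrite ger0_norm//; nra.
have : '[gradf w - gradf z, y - z] <= L * `|y - z| ^+ 2.
  rewrite (le_trans (inner_le _ _))// expr2 mulrA ler_wpM2r//.
  rewrite (le_trans (flip _ _ wr zr))// ler_wpM2l// wz normrZ ger0_norm//.
  by rewrite ler_piMl.
rewrite innerDl innerNl -fyz; lra.
Qed.

Lemma gradient_first_order (f : X -> R) (gradf : X -> X) x (e : R) :
    is_gradient f gradf -> 0 < e ->
  \forall y \near x, - (e * `|y - x|) <= f y - f x - '[gradf x, y - x].
Proof.
move=> fgrad e0; have [df dfE] := fgrad x.
have [_ /eqaddoP] := (diff_locallyP x f).1 df.
move=> /(_ e e0) /nbhs_ballP[r /= r0 h].
apply/nbhs_ballP; exists r => //= y; rewrite -ball_normE/= => xy.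
have := h (y - x); rewrite -ball_normE/= sub0r normrN distrC => /(_ xy).
rewrite /= !fctE subrK dfE ler_norml => /andP[+ _].
by rewrite opprD addrA.
Qed.

End SmoothFunctions.

(** * Optimality conditions of a proximal step *)

Section ProximalStep.
Context {R : realType} {X : euclideanType R}.
Variables (f : X -> R) (gradf : X -> X) (g : X -> \bar R).
Hypotheses (f_grad : is_gradient f gradf) (g_gtNy : forall x, (-oo < g x)%E).
Implicit Types (x y z : X).

Lemma regular_subdiff_limiting (h : X -> \bar R) x :
  regular_subdiff h x `<=` limiting_subdiff h x.
Proof.
move=> eta eta_reg; split; first by case: eta_reg.
by exists (fun=> x), (fun=> eta); split => //; exact: cvg_cst.
Qed.

Lemma dist0_le (A : set X) x : A x -> (dist 0%R A <= `|x|%:E)%E.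
Proof. by move=> Ax; apply: ereal_inf_lbound; exists x; rewrite ?subr0. Qed.

Lemma dom_compositeP x :
  dom (composite f g) x <-> g x \is a fin_num.
Proof.
rewrite /dom /composite /= fin_numE gt_eqF//=; split; last first.
  by case: (g x) (g_gtNy x) => [r| |]//= _ _; rewrite -EFinD ltry.
by case: (g x).
Qed.

(** Minimality forces [g y] to be finite, so the comparison descends to the reals, where the common
    term [f z] cancels. *)
Lemma prox_model_min_le gamma z y x :
    is_global_min (prox_model f gradf g gamma z) y -> dom (composite f g) x ->
  dom (composite f g) y /\
  fine (g y) + '[gradf z, y - z] + gamma / 2 * `|y - z| ^+ 2 <=
  fine (g x) + '[gradf z, x - z] + gamma / 2 * `|x - z| ^+ 2.
Proof.
move=> ymin /dom_compositeP xfin; rewrite dom_compositeP.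
have := ymin x; rewrite /prox_model -(fineK xfin).
case gyE : (g y) (g_gtNy y) => [r| |]//= _.
by rewrite -!EFinD lee_fin => h; split => //; move: h; lra.
Qed.

(** Fermat's rule with the sum rule done by hand: minimality of the model bounds [g w - g y] from
    below, the first-order expansion at [y] bounds [f w - f y], and the quadratic term is
    [o(|w - y|)]. *)
Lemma prox_regular_subdiff gamma z y : 0 <= gamma ->
    dom (composite f g) y ->
    is_global_min (prox_model f gradf g gamma z) y ->
  regular_subdiff (composite f g) y (gradf y - gradf z - gamma *: (y - z)).
Proof.
move=> gamma0 ydom ymin; split => //; rewrite limf_einfE.
apply/lee_addgt0Pr => e e0; rewrite -leeBlDr// sub0e.
have e20 : 0 < e / 2 by rewrite divr_gt0.
(* Half of [e] pays for the expansion of [f], half for the quadratic term; [gamma + 1] keeps the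
   radius meaningful when [gamma = 0]. *)
pose V := [set w | w != y -> `|w - y| < e / 2 / (gamma + 1) /\
   - (e / 2 * `|w - y|) <= f w - f y - '[gradf y, w - y]].
have Vy : y^' V.
  have r0 : 0 < e / 2 / (gamma + 1) by rewrite divr_gt0// ltr_wpDl.
  rewrite /dnbhs /within /=.
  near=> w => _ _; split; last by near: w; exact: gradient_first_order.
  rewrite distrC; near: w.
  by apply/nbhs_ballP; exists (e / 2 / (gamma + 1)) => //= w; rewrite -ball_normE.
pose U := V `&` [set w | w != y].
have Uy : y^' U by apply: filterI => //; exact: nbhs_dnbhs_neq.
apply: le_trans (ereal_sup_ubound _); last by exists U.
apply/ereal_infP => _ [w [Vw /= wy] <-]; have [wr wf] := Vw wy.
have yfin := (dom_compositeP y).1 ydom.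
have wy0 : 0 < `|w - y| by rewrite normr_gt0 subr_eq0.
rewrite /composite -(fineK yfin).
(* Where [g w = +oo] the difference quotient is [+oo]. *)
case gwE : (g w) (g_gtNy w) => [r| |]//= _; last first.
  rewrite [X in (X * _)%E](_ : _ = +oo%E)//.
  by rewrite mulyr gtr0_sg ?invr_gt0// mul1e leey.
have wdom : dom (composite f g) w by apply/dom_compositeP; rewrite gwE.
have [_] := prox_model_min_le ymin wdom; rewrite gwE/=.
have -> : w - z = (w - y) + (y - z) by rewrite subrKA.
rewrite (normD_sqr (w - y)) (innerDr (gradf z) (w - y)) => min_le.
rewrite -!EFinD lee_fin ler_pdivlMr//.
rewrite (innerDl _ (- (gamma *: (y - z)))) innerDl !innerNl innerZl.
have gr : gamma * `|w - y| <= e / 2.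
  move: wr; rewrite ltr_pdivlMr ?ltr_wpDl// => wr.
  by rewrite ltW// (le_lt_trans _ wr)// mulrC ler_wpM2l// ltW// ltr_pwDr.
have : gamma / 2 * `|w - y| ^+ 2 <= e / 2 * `|w - y|.
  rewrite expr2; nra.
rewrite (innerC (y - z) (w - y)).
lra.
Unshelve. all: by end_near.
Qed.

End ProximalStep.

(** * Concave functions, and window maxima of real sequences *)

Section RealSequences.
Context {R : realType}.

(** By concavity every difference quotient at [t] in the direction [s - t], with [0 < h < 1], is at
    least [chi s - chi t]; let [h] tend to 0 from the right. *)
Lemma concave_tangent (D : set R) (chi : R -> R) (s t : R) :
    @convex_function R R^o D (fun u => - chi u) -> D s -> D t ->
    derivable chi t 1 ->
  chi s <= chi t + derive1 chi t * (s - t).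
Proof.
move=> chi_conc Ds Dt dchi.
rewrite -lerBlDl.
have chi_diff : differentiable chi t by apply/derivable1_diffP.
pose slope (h : R) := h^-1 *: ((chi \o shift t) (h *: (s - t)) - chi t).
have slope_cvg : slope h @[h --> 0^'+] --> derive1 chi t * (s - t).
  rewrite mulrC -[X in _ --> X]/((s - t) *: derive1 chi t).
  rewrite -[X in _ --> X]/((fun u : R => u *: derive1 chi t) (s - t)).
  rewrite -(diff1E chi_diff) -deriveE//.
  by apply: cvg_dnbhs_at_right; exact: (@diff_derivable _ _ _ chi t (s - t)).
apply: (cvgr_to_ge slope_cvg).
near=> h.
have h0 : 0 < h by near: h; exact: nbhs_right_gt.
have h1 : h < 1 by near: h; exact: nbhs_right_lt.
have h01 : Itv.spec (Itv.num_sem (R:=R)) (Itv.Real `[0%Z, 1%Z]) h.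
  by rewrite /= /Itv.num_sem num_real/= in_itv/= !ltW.
have := chi_conc (Itv.mk h01) s t (mem_set Ds) (mem_set Dt).
rewrite !convRE /= /unstable.onem => conc.
rewrite /slope /= ler_pdivlMl//.
rewrite (_ : h *: (s - t) + t = h * s + (1 - h) * t); first nra.
by rewrite -[h *: _]/(h * _); ring.
Unshelve. all: by end_near.
Qed.

Lemma within_continuous_seq (T U : topologicalType) (A : set T) (h : T -> U)
    (u : nat -> T) (l : T) :
    {within A, continuous h} -> A l -> (\forall n \near \oo, A (u n)) ->
  u @ \oo --> l -> (h \o u) @ \oo --> h l.
Proof.
move=> hcont Al Au ul V /(hcont l) /=.
rewrite /nbhs /= -nbhs_subspace_in// => /ul hV.
near=> n; suff: A (u n) -> V (h (u n)) by apply; near: n.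
by near: n.
Unshelve. all: by end_near.
Qed.

Variables (p Q s : nat -> R) (m : nat) (c : R).
Hypothesis c_gt0 : 0 < c.
Hypothesis p_le_Q : forall j k, (j <= k <= j + m)%N -> p j <= Q k.
Hypothesis Q_attained :
  forall k, exists2 l, (l <= k <= l + m)%N & Q k = p l.
Hypothesis p_decr : forall k, p k.+1 + c * s k ^+ 2 <= Q k.

(** A maximizer of the window ending at [n.+1] is either [n.+1] itself, controlled by [p_decr], or
    already in the window ending at [n]. *)
Lemma window_max_nonincreasing k n : (k <= n)%N -> Q n <= Q k.
Proof.
apply: (@homo_leq _ Q (fun x y => y <= x)) => //.
  by move=> y x z /[swap]; exact: le_trans.
move=> {n} n; have [l ln ->] := Q_attained n.+1.
have [->|ln1] := eqVneq l n.+1; last by apply: p_le_Q; lia.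
by apply: le_trans (p_decr n); rewrite lerDl mulr_ge0 ?sqr_ge0// ltW.
Qed.

Lemma window_step_bound (L : R) k : 0 <= L ->
    (forall j, (k <= j < k + m.+1)%N -> p j.+1 <= p j + L * s j ^+ 2) ->
  Q k - p k <= (1 + L / c) ^+ m.+1 * (Q k - Q (k + m.+1)%N) /\
  c * s k ^+ 2 <= (1 + L / c) ^+ m.+1 * (Q k - Q (k + m.+1)%N).
Proof.
move=> L_ge0 p_incr; set D := Q k - Q _; set lam := L / c.
have lam0 : 0 <= lam by rewrite divr_ge0// ltW.
have D0 : 0 <= D.
  by rewrite /D subr_ge0; apply: window_max_nonincreasing; exact: leq_addr.
(* Here [l + m >= k + m.+1], hence [l > k]: the descent below reaches both [k.+1] and [k]. *)
have [l lk Ql] := Q_attained (k + m.+1).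
(* Induction on the distance [i] from [j] to [l], where the gap is exactly [D]. A step back adds at
   most [L * s j ^+ 2], which is at most [lam] times the gap at [j.+1]. *)
have gap i j : (j + i)%N = l -> (k <= j)%N -> Q k - p j <= (1 + lam) ^+ i * D.
  elim: i j => [|i IH] j jl kj.
    by rewrite expr0 mul1r /D Ql -jl addn0.
  have := IH j.+1 ltac:(lia) ltac:(lia); set e := (1 + lam) ^+ i * D => IHj.
  have Qjk : Q j <= Q k by exact: window_max_nonincreasing.
  have cs : c * s j ^+ 2 <= Q k - p j.+1.
    by rewrite lerBrDr addrC (le_trans (p_decr j)).
  have Ls : L * s j ^+ 2 <= lam * (Q k - p j.+1).
    by rewrite /lam mulrAC ler_pdivlMr// mulrAC -mulrA ler_wpM2l// mulrC.
  rewrite exprS -mulrA -/e.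
  have := p_incr j ltac:(lia); nra.
have powD i : (i <= m.+1)%N -> (1 + lam) ^+ i * D <= (1 + lam) ^+ m.+1 * D.
  by move=> im; rewrite ler_wpM2r// ler_weXn2l// lerDl.
split.
  by apply: le_trans (powD (l - k)%N _); [apply: gap|]; lia.
apply: le_trans (_ : Q k - p k.+1 <= _); first by rewrite lerBrDr addrC.
by apply: le_trans (powD (l - k.+1)%N _); [apply: gap|]; lia.
Qed.

End RealSequences.

(** * A contraction estimate near a cluster point forces convergence *)

Section Trapping.
Context {R : realType} {X : euclideanType R}.
Variables (x : nat -> X) (xbar : X) (a chi : nat -> R) (N n0 : nat).
Variables (rho E C : R).
Hypotheses (rho_gt0 : 0 < rho) (E_ge0 : 0 <= E) (C_ge0 : 0 <= C).
Hypothesis a_ge0 : forall n, (n0 <= n)%N -> 0 <= a n.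
Hypothesis chi_ge0 : forall n, (n0 <= n)%N -> 0 <= chi n.
Hypotheses (a_cvg0 : a @ \oo --> (0 : R)) (chi_cvg0 : chi @ \oo --> (0 : R)).
Hypothesis step_le : forall n, (n0 <= n)%N -> `|x n - xbar| < rho ->
  `|x n.+1 - x n| <= E * a n.
Hypothesis contraction : forall n, (n0 <= n)%N ->
  (forall i, (i <= N)%N -> `|x (n + i)%N - xbar| < rho) ->
  2 * a (n + N)%N <= a n + C * (chi (n + N)%N - chi (n + N + N)%N).

(** A potential: passing from [n] to [n.+1] telescopes both sums, so [contraction] says exactly that
    [W] drops by at least [a (n + N)]. *)
Let W n := \sum_(i < N) a (n + i)%N + C * \sum_(i < N) chi (n + N + i)%N.

Let cvg0D (u v : nat -> R) : u @ \oo --> (0 : R) -> v @ \oo --> (0 : R) ->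
  (fun n => u n + v n) @ \oo --> (0 : R).
Proof. by move=> u0 v0; rewrite -[0]addr0; exact: cvgD. Qed.

Let cvg0M (k : R) (u : nat -> R) : u @ \oo --> (0 : R) ->
  (fun n => k * u n) @ \oo --> (0 : R).
Proof.
by move=> u0; rewrite -[0](mulr0 k); apply: cvgM => //; exact: cvg_cst.
Qed.

Let W_cvg0 : W @ \oo --> (0 : R).
Proof.
have shift_cvg0 (u : nat -> R) k :
    u @ \oo --> (0 : R) -> (fun n => u (n + k)%N) @ \oo --> (0 : R).
  by move=> u0; rewrite -(cvg_shiftn k) in u0.
have sum_cvg0 M (u : nat -> nat -> R) :
    (forall i, (fun n => u n i) @ \oo --> (0 : R)) ->
    (fun n => \sum_(i < M) u n i) @ \oo --> (0 : R).
  move=> u0; elim: M => [|M IH].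
    by under eq_fun do rewrite big_ord0; exact: cvg_cst.
  under eq_fun do rewrite big_ord_recr/=.
  by apply: cvg0D; [exact: IH|exact: u0].
have a_sum : (fun n => \sum_(i < N) a (n + i)%N) @ \oo --> (0 : R).
  by apply: (sum_cvg0 N (fun n i => a (n + i)%N)) => i; apply: (shift_cvg0 a).
suff chi_sum : (fun n => \sum_(i < N) chi (n + N + i)%N) @ \oo --> (0 : R).
  by apply: cvg0D; [exact: a_sum|exact: cvg0M].
apply: (sum_cvg0 N (fun n i => chi (n + N + i)%N)) => i.
under eq_fun do rewrite -addnA.
exact: (shift_cvg0 chi).
Qed.

Let W_ge n j : (n0 <= n)%N -> (j <= N)%N -> \sum_(i < j) a (n + i)%N <= W n.
Proof.
move=> n0n jN; rewrite -[leLHS]addr0 lerD//; last first.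
  by rewrite mulr_ge0// sumr_ge0// => i _; apply: chi_ge0; lia.
rewrite -(subnKC jN) big_split_ord/= lerDl sumr_ge0// => i _.
by apply: a_ge0; lia.
Qed.

Let shift_sum (u : nat -> R) n :
  \sum_(i < N) u (n.+1 + i)%N = \sum_(i < N) u (n + i)%N + u (n + N)%N - u n.
Proof.
have recl : \sum_(i < N.+1) u (n + i)%N =
    u n + \sum_(i < N) u (n.+1 + i)%N.
  rewrite big_ord_recl addn0; congr (_ + _); apply: eq_bigr => i _.
  by rewrite /= /bump addnA addn1.
by rewrite big_ord_recr/= in recl; rewrite recl addrAC subrr add0r.
Qed.

Let W_succ n : (n0 <= n)%N ->
  (forall i, (i <= N)%N -> `|x (n + i)%N - xbar| < rho) ->
  a (n + N)%N + W n.+1 <= W n.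
Proof.
move=> n0n xn; have := contraction n0n xn.
by rewrite /W addSn !shift_sum; lra.
Qed.

(** Start at an index [n1] of the subsequence where both the distance to [xbar] and [W] are small;
    the total length of all later steps is then paid for by [W n1]. *)
Lemma cluster_point_trap (K : nat -> nat) : {homo K : i j / (i < j)%N} ->
  (x \o K) @ \oo --> xbar -> x @ \oo --> xbar.
Proof.
move=> K_incr xK; apply/cvgrPdist_lt => e e0.
have K_ge i : (i <= K i)%N.
  by elim: i => // i IH; apply: leq_ltn_trans IH (K_incr _ _ _).
pose r := Num.min e rho.
have r0 : 0 < r by rewrite lt_min e0.
have K_oo : K @ \oo --> \oo.
  apply/cvgnyPge => k; exists k => // i /= ki; exact: leq_trans (K_ge i).
have start_cvg : (fun i => `|x (K i) - xbar| + 2 * E * W (K i)) @ \oo --> (0 : R).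
  have WK : (W \o K) @ \oo --> (0 : R) by exact: cvg_comp K_oo W_cvg0.
  apply: cvg0D; last exact: cvg0M.
  rewrite -(normr0 X); apply: cvg_norm; rewrite -(subrr xbar).
  by apply: cvgB; [exact: xK|exact: cvg_cst].
(* The factor 2 pays twice: one [E * W n1] for the first [N] steps, taken before [contraction]
   applies, and one for all later steps. *)
have [n1 n0n1 start] : exists2 n1, (n0 <= n1)%N &
    `|x n1 - xbar| + 2 * E * W n1 < r.
  have [i0 _ start] := cvgr_lt _ start_cvg _ r0.
  exists (K (maxn i0 n0)); first by rewrite (leq_trans (leq_maxr i0 n0)).
  by apply: start => /=; exact: leq_maxl.
have W0 n : (n0 <= n)%N -> 0 <= W n.
  by move=> n0n; have := W_ge n0n (leq0n N); rewrite big_ord0.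
have rrho y : y < r -> y < rho by rewrite lt_min => /andP[].
have partial_lt i : (i <= N)%N ->
    `|x n1 - xbar| + E * \sum_(j < i) a (n1 + j)%N < r.
  move=> iN; have := ler_wpM2l E_ge0 (W_ge n0n1 iN).
  have := mulr_ge0 E_ge0 (W0 _ n0n1); move: start; lra.
have first_window i : (i <= N)%N ->
    `|x (n1 + i)%N - xbar| <= `|x n1 - xbar| + E * \sum_(j < i) a (n1 + j)%N.
  elim: i => [|i IH] iN; first by rewrite big_ord0 mulr0 addr0 addn0.
  have {}IH := IH (ltnW iN).
  have := step_le (leq_trans n0n1 (leq_addr i n1))
    (rrho _ (le_lt_trans IH (partial_lt _ (ltnW iN)))).
  rewrite big_ord_recr/= mulrDr addnS.
  have := ler_normD (x (n1 + i).+1 - x (n1 + i)%N) (x (n1 + i)%N - xbar).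
  rewrite subrKA; lra.
(* Invariant: the last [N + 1] iterates are close, and the distance of the newest one plus the
   remaining budget [E * W] stays below [r]. The next step has length at most [E * a (n1 + d + N)],
   which the drop of [W] compensates. *)
have trapped d : (forall i, (i <= N)%N -> `|x (n1 + d + i)%N - xbar| < r) /\
    `|x (n1 + d + N)%N - xbar| + E * W (n1 + d)%N < r.
  elim: d => [|d [IHr IHW]].
    rewrite addn0; split=> [i iN|].
      exact: le_lt_trans (first_window _ iN) (partial_lt _ iN).
    have := first_window _ (leqnn N).
    have := ler_wpM2l E_ge0 (W_ge n0n1 (leqnn N)); move: start; lra.
  have n0d : (n0 <= n1 + d)%N by lia.
  have n0dN : (n0 <= n1 + d + N)%N by lia.
  have xrho i : (i <= N)%N -> `|x (n1 + d + i)%N - xbar| < rho.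
    by move=> iN; apply: rrho; exact: IHr.
  have W_decr := ler_wpM2l E_ge0 (W_succ n0d xrho).
  have step := step_le n0dN (xrho N (leqnn N)).
  have EW0 : 0 <= E * W (n1 + d).+1 by rewrite mulr_ge0// W0//; lia.
  have last_lt : `|x (n1 + d + N).+1 - xbar| + E * W (n1 + d).+1 < r.
    have := ler_normD (x (n1 + d + N).+1 - x (n1 + d + N)%N)
      (x (n1 + d + N)%N - xbar).
    move: W_decr step IHW; rewrite subrKA mulrDr; lra.
  rewrite addnS addSn; split => // i iN.
  have [->|iN'] := eqVneq i N; first by rewrite addSn; lra.
  by rewrite addSnnS; apply: IHr; lia.
exists n1 => // n /= n1n; rewrite distrC.
have [/(_ 0 isT)] := trapped (n - n1)%N.
by rewrite addn0 subnKC// lt_min => /andP[].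
Qed.

End Trapping.

(** * Properties of the algorithm: finiteness, decrease and stepsize bounds *)

Section NonmonotoneProximalGradientFacts.
Context {R : realType} {X : euclideanType R}.
Variables (f : X -> R) (gradf : X -> X) (g : X -> \bar R).
Hypotheses (f_grad : is_gradient f gradf) (g_gtNy : forall x, (-oo < g x)%E).
Implicit Types (x : nat -> X) (y z : X).

(** The real-valued form of [composite]; meaningful only on its domain, since [fine] sends [+oo] to
    0. *)
Definition objective y : R := f y + fine (g y).

Lemma compositeE y : dom (composite f g) y ->
  composite f g y = (objective y)%:E.
Proof.
by move=> /(dom_compositeP _ g_gtNy) yfin; rewrite /composite -(fineK yfin).
Qed.

Lemma le_max_window m x j k : (j <= k <= j + m)%N ->
  (composite f g (x j) <= max_window f g m x k)%E.
Proof.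
move=> jk; have jlt : (k - j < (minn k m).+1)%N by lia.
rewrite -(subKn (_ : j <= k)%N); last by lia.
exact: (le_bigmax_cond -oo%E (fun i : 'I_(minn k m).+1 =>
  composite f g (x (k - i)%N)) (isT : xpredT (Ordinal jlt))).
Qed.

Lemma max_window_attained m x k :
  exists2 l, (l <= k <= l + m)%N & max_window f g m x k = composite f g (x l).
Proof.
rewrite /max_window.
have [|i _ ->] := @eq_bigmax _ _ _ -oo%E (@ord0 (minn k m)) xpredT
  (fun i => composite f g (x (k - i)%N)) isT.
  by move=> i _; exact: leNye.
by exists (k - i)%N => //; have := ltn_ord i; lia.
Qed.

(** A rejected parameter cannot be large. For large [gamma] the affine minorant of [g] keeps the
    trial point within distance 1 of [z]; there the descent inequality with
    [L < (1 - delta) * (gamma / 2)] contradicts the failure of the decrease test. *)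
Lemma prox_parameter_bound (a xbar : X) (b B L delta : R) : delta < 1 ->
    (forall y, (('[a, y] + b)%:E <= g y)%E) -> continuous gradf -> 0 <= L ->
    (forall y z, `|y - xbar| <= 2 -> `|z - xbar| <= 2 ->
       `|gradf y - gradf z| <= L * `|y - z|) ->
  exists G : R, forall z y (gamma : R), `|z - xbar| <= 1 ->
    dom (composite f g) z -> objective z <= B ->
    is_global_min (prox_model f gradf g gamma z) y ->
    objective z < objective y + delta * (gamma / 2) * `|y - z| ^+ 2 ->
  gamma <= G.
Proof.
move=> delta1 g_affine gradf_cont L0 gradf_lip.
have Kcomp : compact [set z | `|z - xbar| <= 1] by exact: compact_norm_ball.
have [Mf Mf0 fM] : exists2 M : R, 0 < M &
    forall z, `|z - xbar| <= 1 -> `|f z| <= M.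
  apply: continuous_compact_bounded Kcomp => z.
  by apply: differentiable_continuous; case: (f_grad z).
have [Mg Mg0 gM] := continuous_compact_bounded gradf_cont Kcomp.
pose A0 := `|B| + Mf + `|b| + `|a| * (`|xbar| + 1).
pose G0 := Mg + `|a|.
have A00 : 0 <= A0 by rewrite !addr_ge0 ?mulr_ge0 ?addr_ge0// ltW.
have G00 : 0 <= G0 by rewrite addr_ge0// ltW.
(* The first summand rules out [|y - z| > 1] through [gamma / 2 * |y - z| ^+ 2 <= A0 + G0 * |y -
   z|]; the second one gives the inequality on [L] above. *)
exists (2 * (A0 + G0) + 2 * L / (1 - delta)) => z y gamma zr zdom zB ymin fail.
have d10 : 0 < 1 - delta by rewrite subr_gt0.
rewrite leNgt; apply/negP => Gg.
have LG : 0 <= 2 * L / (1 - delta) by rewrite divr_ge0 ?mulr_ge0// ltW.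
have [ydom] := prox_model_min_le g_gtNy ymin zdom.
rewrite subrr linear0r normr0 expr0n /= !(mulr0, addr0) => ymodel.
have ya : '[a, y] + b <= fine (g y).
  by rewrite -lee_fin fineK//; exact: (dom_compositeP f g_gtNy y).1.
have d1 : `|y - z| <= 1.
  rewrite leNgt; apply/negP => d1.
  have az : - (`|a| * (`|xbar| + 1)) <= '[a, z].
    rewrite lerNl -innerNr (le_trans (inner_le _ _))// ler_wpM2l// normrN.
    by rewrite -(subrK xbar z) (le_trans (ler_normD _ _))// addrC lerD2l.
  have ad : - (`|a| * `|y - z|) <= '[a, y - z].
    by rewrite lerNl -innerNr (le_trans (inner_le _ _))// normrN.
  have gd : - (Mg * `|y - z|) <= '[gradf z, y - z].
    rewrite lerNl -innerNr (le_trans (inner_le _ _))// normrN ler_wpM2r//.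
    exact: gM.
  have ay : '[a, y] = '[a, y - z] + '[a, z] by rewrite -innerDr subrK.
  have key : gamma / 2 * `|y - z| ^+ 2 <= A0 + G0 * `|y - z|.
    have := fM z zr; rewrite ler_norml => /andP[fz _].
    have := ler_norm B; have := ler_norm (- b); rewrite normrN.
    move: zB; rewrite /objective /A0 /G0; lra.
  have dd : `|y - z| <= `|y - z| ^+ 2 by rewrite expr2 ler_peMr// ltW.
  have d2 : 1 <= `|y - z| ^+ 2 by rewrite (le_trans (ltW d1)).
  nra.
have yr : `|y - xbar| <= 2.
  rewrite -(subrK z y) -addrA (le_trans (ler_normD _ _))//.
  by rewrite (_ : 2 = 1 + 1 :> R)// lerD.
have zr2 : `|z - xbar| <= 2 by rewrite (le_trans zr)// ler1n.
have := descent_on_ball f_grad L0 gradf_lip yr zr2.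
move: fail ymodel; rewrite /objective.
have gL : L < (1 - delta) * (gamma / 2).
  have : 2 * L / (1 - delta) < gamma by lra.
  rewrite ltr_pdivrMr//; lra.
have := sqr_ge0 `|y - z|; nra.
Qed.

(** Strong induction: the window maximum in the acceptance test is the value at an earlier iterate,
    hence finite. *)
Lemma npg_max_sequence_dom tau gmin gmax delta m x : 0 < gmin -> 1 < tau ->
    0 < delta -> npg_max_sequence f gradf g tau gmin gmax delta m x ->
  forall k, dom (composite f g) (x k).
Proof.
move=> gmin0 tau1 delta0 [x0dom [gamma0 [trial [istop npg]]]] k.
elim/ltn_ind: k => -[//|k] IH; have [/andP[gk _] _ _ acc xk] := npg k.
have [l lk Ql] := max_window_attained m x k.
rewrite /acceptable -xk Ql in acc; apply: le_lt_trans acc _.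
have ldom : dom (composite f g) (x l) by apply: IH; lia.
by rewrite (compositeE ldom) -EFinB ltry.
Qed.

(** Hides the inner loop. In the last clause either the initial parameter was accepted, or the trial
    just before acceptance, with parameter [gamma / tau], was rejected. *)
Lemma npg_max_sequence_step tau gmin gmax delta m x : 0 < gmin -> 1 < tau ->
    0 < delta -> npg_max_sequence f gradf g tau gmin gmax delta m x ->
  forall k, exists2 gamma : R, gmin <= gamma &
    [/\ is_global_min (prox_model f gradf g gamma (x k)) (x k.+1),
      objective (x k.+1) + delta * (gmin / 2) * `|x k.+1 - x k| ^+ 2 <=
        fine (max_window f g m x k) &
      gamma <= gmax \/ exists gamma' y, [/\ gamma = tau * gamma',
        is_global_min (prox_model f gradf g gamma' (x k)) y &
        fine (max_window f g m x k) <
          objective y + delta * (gamma' / 2) * `|y - x k| ^+ 2]].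
Proof.
move=> gmin0 tau1 delta0 npg0 k.
have xdom := npg_max_sequence_dom gmin0 tau1 delta0 npg0.
have [_ [gamma0 [trial [istop npg]]]] := npg0.
have [/andP[gk gk'] minimal reject accept xk] := npg k.
have [l lk Ql] := max_window_attained m x k.
have tau0 : 0 < tau by rewrite (lt_trans _ tau1).
have gmin_le : gmin <= tau ^+ istop k * gamma0 k.
  rewrite (le_trans gk)// ler_peMl ?(le_trans (ltW gmin0))//.
  by rewrite exprn_ege1// ltW.
exists (tau ^+ istop k * gamma0 k) => //; split.
- by rewrite xk; exact: minimal.
- move: accept; rewrite /acceptable -xk Ql !compositeE// -EFinB lee_fin /=.
  rewrite lerBrDr; apply: le_trans; rewrite lerD2l ler_wpM2r ?sqr_ge0//.
  by rewrite ler_wpM2l ?ler_wpM2r// ltW.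
- case istopE : (istop k) => [|i]; first by left; rewrite expr0 mul1r.
  right; exists (tau ^+ i * gamma0 k), (trial k i).
  have ik : (i < istop k)%N by rewrite istopE.
  have ymin := minimal i (ltnW ik).
  have [ydom _] := prox_model_min_le g_gtNy ymin (xdom k).
  split => //; first by rewrite exprS mulrA.
  have /negP := reject i ik.
  by rewrite /acceptable Ql !compositeE// -EFinB lee_fin -ltNge ltrBlDr.
Qed.

End NonmonotoneProximalGradientFacts.

Lemma le_mean_of_sqr_le_mul (R : realFieldType) (a b d : R) :
  0 <= b -> 0 <= d -> a ^+ 2 <= b * d -> 2 * a <= b + d.
Proof.
move=> b0 d0 abd; rewrite leNgt; apply/negP => lt_bd.
have := sqr_ge0 (b - d); nra.
Qed.

(** The KL inequality is applied at a maximizer [l], and the subgradient available there comes from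
    the step that leads from [l'] to [l]. *)
Lemma window_index (n m l : nat) : (l <= n + m.+1 <= l + m)%N ->
  exists2 l', l = l'.+1 & (n <= l' < n + m.+1)%N.
Proof. by move=> lnm; exists l.-1; lia. Qed.

(** * Convergence under the KL property *)

Section Convergence.
Context {R : realType} {X : euclideanType R}.
Variables (f : X -> R) (gradf : X -> X) (g : X -> \bar R).
Variables (m : nat) (c M : R) (x : nat -> X) (gamma : nat -> R) (xbar : X).
Hypotheses (f_grad : is_gradient f gradf) (gradf_cont : continuous gradf).
Hypotheses (gradf_lip : locally_lipschitz gradf).
Hypotheses (g_gtNy : forall x, (-oo < g x)%E) (c_gt0 : 0 < c).
Hypothesis x_dom : forall k, dom (composite f g) (x k).
Hypothesis gamma_gt0 : forall k, 0 < gamma k.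
Hypothesis x_prox : forall k,
  is_global_min (prox_model f gradf g (gamma k) (x k)) (x k.+1).

Let p k := objective f g (x k).
Let Q k := fine (max_window f g m x k).
Let s k := `|x k.+1 - x k|.
Let D k := Q k - Q (k + m.+1)%N.

Hypothesis p_ge : forall k, M <= p k.
Hypothesis p_decr : forall k, p k.+1 + c * s k ^+ 2 <= Q k.

Let p_le_Q j k : (j <= k <= j + m)%N -> p j <= Q k.
Proof.
move=> jk; have := le_max_window f g x jk.
have [l lk Ql] := max_window_attained f g m x k.
by rewrite /p /Q Ql !(compositeE g_gtNy)// lee_fin.
Qed.

Let Q_attained k : exists2 l, (l <= k <= l + m)%N & Q k = p l.
Proof.
have [l lk Ql] := max_window_attained f g m x k.
by exists l => //; rewrite /p /Q Ql (compositeE g_gtNy).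
Qed.

Let Q_noninc k n : (k <= n)%N -> Q n <= Q k.
Proof. exact: (window_max_nonincreasing c_gt0 p_le_Q Q_attained p_decr). Qed.

Lemma objective_le_start k : p k <= Q 0%N.
Proof. by rewrite (le_trans _ (Q_noninc (leq0n k)))// p_le_Q//; lia. Qed.

Let D_ge0 k : 0 <= D k.
Proof. by rewrite /D subr_ge0; apply: Q_noninc; exact: leq_addr. Qed.

Let Q_cvg : cvgn Q.
Proof.
apply: nonincreasing_is_cvgn; first by move=> k n; exact: Q_noninc.
exists M => _ [k _ <-]; have [l _ ->] := Q_attained k; exact: p_ge.
Qed.

Let D_cvg0 : D @ \oo --> (0 : R).
Proof.
rewrite -(subrr (limn Q)); apply: cvgB; first exact: Q_cvg.
have := Q_cvg; rewrite -(cvg_shiftn m.+1 Q); exact.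
Qed.

(** Each [c * s k ^+ 2] is at most [Q k - p k.+1], hence at most [Q 0 - M]. *)
Let step_bounded : exists2 S : R, 0 <= S & forall k, s k <= S.
Proof.
exists (Num.sqrt ((Q 0%N - M) / c)) => [|k]; first exact: sqrtr_ge0.
have s0 : 0 <= s k by exact: normr_ge0.
rewrite -(ger0_norm s0) -sqrtr_sqr ler_wsqrtr// ler_pdivlMr// mulrC.
have := p_decr k; have := p_ge k.+1; have := Q_noninc (leq0n k); lra.
Qed.

Lemma local_step_bound : exists2 Lam : R, 0 <= Lam &
  forall k, `|x k - xbar| < 1 -> Q k - p k <= Lam * D k /\
                                c * s k ^+ 2 <= Lam * D k.
Proof.
have [S S0 sS] := step_bounded.
(* Starting within 1 of [xbar], [m.+1] steps of length at most [S] stay in this ball, whatever [k]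
   is. *)
have [L L0 gradf_L] := locally_lipschitz_compact gradf_cont gradf_lip
  (@compact_norm_ball _ _ xbar (1 + m.+1%:R * S)).
exists ((1 + L / c) ^+ m.+1).
  by rewrite exprn_ge0// addr_ge0// divr_ge0// ltW.
move=> k xk.
have x_near i : (i <= m.+1)%N -> `|x (k + i)%N - xbar| <= 1 + i%:R * S.
  elim: i => [|i IH] im; first by rewrite addn0 mul0r addr0 ltW.
  have := IH (ltnW im); have := sS (k + i)%N; rewrite /s addnS -natr1.
  have := ler_normD (x (k + i).+1 - x (k + i)%N) (x (k + i)%N - xbar).
  rewrite subrKA; lra.
have x_ball i : (i <= m.+1)%N -> `|x (k + i)%N - xbar| <= 1 + m.+1%:R * S.
  by move=> im; rewrite (le_trans (x_near i im))// lerD2l ler_wpM2r// ler_nat.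
apply: (window_step_bound c_gt0 p_le_Q Q_attained p_decr (ltW L0)) => j kj.
(* The model is compared with its value at the current iterate; the descent inequality then gives an
   increase of at most [L * s j ^+ 2], with no upper bound on [gamma j]. *)
have [_] := prox_model_min_le g_gtNy (x_prox j) (x_dom j).
rewrite subrr linear0r normr0 expr0n /= !(mulr0, addr0) => model.
have jr : `|x j - xbar| <= 1 + m.+1%:R * S.
  by have := x_ball (j - k)%N ltac:(lia); rewrite subnKC//; lia.
have j1r : `|x j.+1 - xbar| <= 1 + m.+1%:R * S.
  have := x_ball (j.+1 - k)%N ltac:(lia).
  by rewrite (_ : (k + (j.+1 - k))%N = j.+1)//; lia.
have := descent_on_ball f_grad (ltW L0) gradf_L j1r jr.
have : 0 <= gamma j / 2 * s j ^+ 2.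
  by rewrite mulr_ge0 ?sqr_ge0// divr_ge0// ltW.
rewrite /p /objective /s; lra.
Qed.

Variable K : nat -> nat.
Hypotheses (K_incr : {homo K : i j / (i < j)%N}).
Hypothesis x_sub : (x \o K) @ \oo --> xbar.
Hypothesis q_cont : {within dom (composite f g), continuous (composite f g)}.
Hypothesis xbar_dom : dom (composite f g) xbar.

Let K_oo : K @ \oo --> \oo.
Proof.
apply/cvgnyPge => k; exists k => // i /= ki; apply: (leq_trans ki).
by elim: i {ki} => // i IH; apply: leq_ltn_trans IH (K_incr _).
Qed.

(** Along the subsequence [p] tends to the value at [xbar] by continuity on the domain, while
    [Q - p] is at most [Lam * D], which tends to 0. *)
Lemma limit_max_window : Q @ \oo --> objective f g xbar.
Proof.
have pK : (p \o K) @ \oo --> objective f g xbar.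
  have xK_dom : \forall i \near \oo, dom (composite f g) ((x \o K) i).
    by apply: nearW => i; exact: x_dom.
  have := within_continuous_seq q_cont xbar_dom xK_dom x_sub.
  rewrite (compositeE g_gtNy xbar_dom) => /fine_cvg pK.
  rewrite (_ : p \o K = fine \o (composite f g \o (x \o K)))//.
  by apply/funext => i /=; rewrite (compositeE g_gtNy (x_dom _)).
have QK : (Q \o K) @ \oo --> limn Q by exact: cvg_comp K_oo Q_cvg.
have DK : (D \o K) @ \oo --> (0 : R) by exact: cvg_comp K_oo D_cvg0.
have [Lam Lam0 LamP] := local_step_bound.
suff -> : objective f g xbar = limn Q by exact: Q_cvg.
apply/eqP; rewrite eq_le; apply/andP; split.
  by apply: (ler_cvg_to pK QK); apply: nearW => i; apply: p_le_Q; lia.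
have QDK : (fun i => Q (K i) - Lam * D (K i)) @ \oo --> limn Q.
  rewrite -[limn Q]subr0 -(mulr0 Lam); apply: cvgB; first exact: QK.
  by apply: cvgM; [exact: cvg_cst|exact: DK].
apply: (ler_cvg_to QDK pK); near=> i.
have [] : Q (K i) - p (K i) <= Lam * D (K i) /\
    c * s (K i) ^+ 2 <= Lam * D (K i).
  apply: LamP; rewrite distrC; near: i.
  by move/cvgrPdist_lt : x_sub; apply.
by rewrite /=; lra.
Unshelve. all: by end_near.
Qed.

Lemma limit_max_window_le k : objective f g xbar <= Q k.
Proof.
rewrite -(cvg_lim _ limit_max_window)//.
by apply: nonincreasing_cvgn_ge => // i j; exact: Q_noninc.
Qed.

Variable Gam : R.
Hypotheses (Gam_ge0 : 0 <= Gam).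
Hypothesis gamma_le : forall k, `|x k - xbar| <= 1 -> gamma k <= Gam.
Hypothesis q_KL : KL_property (composite f g) xbar.

Lemma npg_cvg : x @ \oo --> xbar.
Proof.
have [_ [eta [U [chi [eta0 /nbhs_ballP[r /= r0 rU] chi_desing KL]]]]] := q_KL.
have [chi_ge chi_cont chi_conc chi0 chi_der] := chi_desing.
set qbar := objective f g xbar.
have Q_lim : Q @ \oo --> qbar by exact: limit_max_window.
have Q_ge k : qbar <= Q k by exact: limit_max_window_le.
have [n0 _ Q_lt] : \forall n \near \oo, Q n < qbar + eta.
  by apply: (cvgr_lt _ Q_lim); rewrite ltrDl.
have Q_itv k : (n0 <= k)%N -> Q k - qbar \in `[0, eta].
  move=> n0k; rewrite in_itv/= subr_ge0 Q_ge/= lerBlDl ltW//.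
  exact: Q_lt.
have [Lam Lam0 LamP] := local_step_bound.
have [L L0 gradf_L] := locally_lipschitz_compact gradf_cont gradf_lip
  (@compact_norm_ball _ _ xbar 1).
pose rho := Num.min r 1.
have rho0 : 0 < rho by rewrite lt_min r0 ltr01.
have rho_r y : `|y - xbar| < rho -> U y /\ `|y - xbar| < 1.
  rewrite lt_min => /andP[yr y1]; split => //; apply: rU.
  by rewrite -ball_normE/= distrC.
have sqrtc0 : 0 < Num.sqrt c by rewrite sqrtr_gt0.
have LG0 : 0 <= L + Gam by rewrite addr_ge0// ltW.
(* The constant [Num.sqrt (Lam / c)] comes from [local_step_bound]. In the other one, [L + Gam]
   bounds the subgradient per unit of step length and [1 / Num.sqrt c] bounds the step by
   [Num.sqrt (D n)]. *)
apply: (@cluster_point_trap _ _ x xbar (fun k => Num.sqrt (D k))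
  (fun k => chi (Q k - qbar)) m.+1 n0 rho (Num.sqrt (Lam / c))
  ((L + Gam) / Num.sqrt c) _ _ _ _ _ _ _ _ _ K K_incr x_sub) => //.
- by rewrite divr_ge0// ltW.
- by move=> n n0n; apply: chi_ge; exact: Q_itv.
- by rewrite -sqrtr0; apply: (cvg_comp D _ D_cvg0); exact: sqrt_continuous.
- rewrite -chi0; apply: (within_continuous_seq chi_cont).
  + by rewrite /= in_itv/= lexx ltW.
  + by exists n0 => // n; exact: Q_itv.
  + by rewrite -(subrr qbar); apply: cvgB => //; exact: cvg_cst.
- move=> n _ /rho_r[_ /LamP[_ sn]].
  rewrite -(ger0_norm (normr_ge0 (x n.+1 - x n))) -sqrtr_sqr -sqrtrM; last first.
    by rewrite divr_ge0// ltW.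
  by rewrite ler_wsqrtr// mulrAC ler_pdivlMr// mulrC.
move=> n n0n x_rho; set k := (n + m.+1)%N.
have n0k : (n0 <= k)%N by rewrite (leq_trans n0n)// leq_addr.
have n0kN : (n0 <= k + m.+1)%N by rewrite (leq_trans n0k)// leq_addr.
have Q_kN : Q (k + m.+1)%N <= Q k by apply: Q_noninc; exact: leq_addr.
have := Q_ge k; rewrite le_eqVlt => /predU1P[Qk|Qk].
  have Q_kN_eq : Q (k + m.+1)%N = Q k by apply/le_anti; rewrite Q_kN -Qk Q_ge.
  by rewrite /D Q_kN_eq !subrr sqrtr0 !mulr0 addr0 sqrtr_ge0.
have [l lk Ql] := Q_attained k.
have [l' El /andP[nl' l'k]] := window_index lk; subst l.
have near_rho j : (n <= j)%N -> (j <= k)%N -> `|x j - xbar| < rho.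
  move=> nj jk; rewrite -(subnKC nj); apply: x_rho.
  by rewrite leq_subLR.
have [_ l'1] := rho_r _ (near_rho l' nl' (ltnW l'k)).
have [lU l1] := rho_r _ (near_rho l'.+1 (leqW nl') l'k).
have Qk_itv : Q k - qbar \in `]0, eta[.
  by rewrite in_itv/= subr_gt0 Qk/= ltrBlDl Q_lt.
have [dchi _ dchi0] := chi_der _ Qk_itv.
set dk := derive1 chi (Q k - qbar) in dchi0.
(* The distance in the KL inequality is at most the norm of the proximal subgradient, whose gradient
   part is bounded by [L * s l'] and whose proximal part by [Gam * s l']. *)
have KL_l : 1 <= dk * ((L + Gam) * s l').
  have xl_dom := x_dom l'.+1.
  have qxl : composite f g (x l'.+1) = (Q k)%:E.
    by rewrite Ql (compositeE g_gtNy xl_dom).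
  have qxbar := compositeE g_gtNy xbar_dom.
  have := KL (x l'.+1) lU; rewrite qxl qxbar -EFinD !lte_fin -EFinB /=.
  move=> /(_ Qk (Q_lt _ n0k)) KL_le.
  rewrite -lee_fin (le_trans KL_le)// EFinM lee_pmul2l ?lte_fin//.
  have sub := regular_subdiff_limiting
    (prox_regular_subdiff f_grad g_gtNy (ltW (gamma_gt0 l')) xl_dom (x_prox l')).
  apply: le_trans (dist0_le sub) _; rewrite lee_fin.
  rewrite (le_trans (ler_normB _ _))// mulrDl lerD//.
    by apply: gradf_L; exact: ltW.
  by rewrite normrZ gtr0_norm// ler_wpM2r// gamma_le// ltW.
(* As [p l'.+1 = Q k] with [k = n + m.+1], and [Q l' <= Q n], the decrease at [l'] is bounded by
   [D n]. *)
have s_le : s l' <= Num.sqrt (D n) / Num.sqrt c.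
  have s0 : 0 <= s l' by exact: normr_ge0.
  rewrite -sqrtrV ?(ltW c_gt0)// -sqrtrM// -(ger0_norm s0) -sqrtr_sqr.
  rewrite ler_wsqrtr// ler_pdivlMr// mulrC.
  have Ql'n : Q l' <= Q n by exact: Q_noninc.
  by have := p_decr l'; rewrite -Ql /D -/k; lra.
have tangent : dk * D k <= chi (Q k - qbar) - chi (Q (k + m.+1)%N - qbar).
  have := concave_tangent chi_conc (Q_itv _ n0kN) (Q_itv _ n0k) dchi.
  by rewrite -/dk /D; nra.
set Delta := chi (Q k - qbar) - _ in tangent *.
have Delta0 : 0 <= Delta by rewrite (le_trans _ tangent)// mulr_ge0// ltW.
have C0 : 0 <= (L + Gam) / Num.sqrt c by rewrite divr_ge0// ltW.
rewrite [leRHS]addrC.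
(* Arithmetic-geometric mean: it suffices that [D k] is at most the product of
   [(L + Gam) / Num.sqrt c * Delta] and [Num.sqrt (D n)], which is the KL bound multiplied by [D k]
   and combined with [tangent]. *)
apply: le_mean_of_sqr_le_mul; [exact: mulr_ge0|exact: sqrtr_ge0|].
rewrite sqr_sqrtr//.
have one_le : 1 <= dk * ((L + Gam) / Num.sqrt c * Num.sqrt (D n)).
  rewrite (le_trans KL_l)// ler_wpM2l ?(ltW dchi0)//.
  by rewrite -mulrA ler_wpM2l// mulrC.
have := ler_wpM2r (D_ge0 k) one_le; rewrite mul1r => /le_trans; apply.
have := ler_wpM2r (mulr_ge0 C0 (sqrtr_ge0 (D n))) tangent; lra.
Qed.

End Convergence.

(** * Reduction of the algorithm to the abstract convergence result *)

Theorem theorem4p8 (R : realType) (X : euclideanType R)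
  (f : X -> R) (gradf : X -> X) (g : X -> \bar R)
  (f_grad : is_gradient f gradf)
  (f_C1 : continuous gradf)
  (g_gtNy : forall x, (-oo < g x)%E)
  (g_lsc : lower_semicontinuous g)
  (q_bounded_below :
     exists M : R, forall x, dom g x -> (M%:E <= composite f g x)%E)
  (g_affine : affinely_minorized g)
  (f_lip : locally_lipschitz gradf)
  (q_cont : {within dom (composite f g), continuous (composite f g)})
  (tau gmin gmax delta : R) (m : nat)
  (tau_gt1 : 1 < tau) (gmin_gt0 : 0 < gmin) (gmin_le : gmin <= gmax)
  (delta_gt0 : 0 < delta) (delta_lt1 : delta < 1)
  (x : nat -> X)
  (x_npg : npg_max_sequence f gradf g tau gmin gmax delta m x)
  (xbar : X) (K : nat -> nat)
  (K_incr : {homo K : i j / (i < j)%N})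
  (x_sub : (x \o K) @ \oo --> xbar)
  (q_KL : KL_property (composite f g) xbar) :
  x @ \oo --> xbar.
Proof.
have tau0 : 0 < tau by rewrite (lt_trans _ tau_gt1).
have x_dom := npg_max_sequence_dom g_gtNy gmin_gt0 tau_gt1 delta_gt0 x_npg.
have step := npg_max_sequence_step g_gtNy gmin_gt0 tau_gt1 delta_gt0 x_npg.
have /choice[gamma gammaP] : forall k, exists gam : R, gmin <= gam /\
    [/\ is_global_min (prox_model f gradf g gam (x k)) (x k.+1),
      objective f g (x k.+1) + delta * (gmin / 2) * `|x k.+1 - x k| ^+ 2 <=
        fine (max_window f g m x k) &
      gam <= gmax \/ exists gam' y, [/\ gam = tau * gam',
        is_global_min (prox_model f gradf g gam' (x k)) y &
        fine (max_window f g m x k) <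
          objective f g y + delta * (gam' / 2) * `|y - x k| ^+ 2]].
  by move=> k; have [gam] := step k; exists gam.
have gamma_gt0 k : 0 < gamma k.
  by have [gk _] := gammaP k; exact: lt_le_trans gk.
have x_prox k : is_global_min (prox_model f gradf g (gamma k) (x k)) (x k.+1).
  by have [_ []] := gammaP k.
have p_decr k : objective f g (x k.+1) +
    delta * (gmin / 2) * `|x k.+1 - x k| ^+ 2 <= fine (max_window f g m x k).
  by have [_ []] := gammaP k.
have c0 : 0 < delta * (gmin / 2) by rewrite mulr_gt0// divr_gt0.
have [M MP] := q_bounded_below.
have p_ge k : M <= objective f g (x k).
  rewrite -lee_fin -(compositeE g_gtNy (x_dom k)) MP//.
  by have /(dom_compositeP _ g_gtNy) := x_dom k; rewrite /dom/= ltey_eq => ->.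
have [a [b g_ge]] := g_affine.
(* Radius 2 holds the iterates within 1 of [xbar] together with trial points at distance at most 1
   from them. *)
have ball_compact : compact [set z | `|z - xbar| <= 2].
  exact: compact_norm_ball.
have [L L0 gradf_L] := locally_lipschitz_compact f_C1 f_lip ball_compact.
have [G GP] := prox_parameter_bound f_grad g_gtNy
  (fine (max_window f g m x 0)) delta_lt1 g_ge f_C1 (ltW L0) gradf_L.
(* An accepted parameter is either an initial one, at most [gmax], or [tau] times a rejected one, at
   most [G]. Absolute values make the bound nonnegative. *)
have gamma_le k : `|x k - xbar| <= 1 -> gamma k <= `|gmax| + tau * `|G|.
  move=> xk; have [_ [_ _ [gk|[gam' [y [-> ymin fail]]]]]] := gammaP k.
    by rewrite (le_trans gk)// (le_trans (ler_norm _))// lerDl mulr_ge0// ltW.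
  have gG : gam' <= G.
    apply: (GP (x k) y) => //.
      exact: (objective_le_start g_gtNy c0 x_dom p_decr).
    (* Failing the test against the window maximum implies failing it against the value at [x k]. *)
    apply: le_lt_trans fail; rewrite -lee_fin -(compositeE g_gtNy (x_dom k)).
    have [l _ Ql] := max_window_attained f g m x k.
    rewrite fineK; first by apply: le_max_window; rewrite leqnn leq_addr.
    by rewrite Ql (compositeE g_gtNy (x_dom l)).
  by rewrite ler_wpDl// ler_pM2l// (le_trans gG)// ler_norm.
(* The KL property includes a limiting subgradient at [xbar], which exists only at points of the
   domain. *)
have xbar_dom : dom (composite f g) xbar by case: q_KL => -[? []].
apply: (npg_cvg f_grad f_C1 f_lip g_gtNy c0 x_dom gamma_gt0 x_prox p_ge p_decr
  K_incr x_sub q_cont xbar_dom _ gamma_le q_KL).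
by rewrite addr_ge0// mulr_ge0// ltW.
Qed.
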